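(* Let $n,k$ be positive integers with $k\ge 50$ and $n\ge 50k\ln k$ (natural logarithm). If $\mathcal F\subset\binom{[n]}{k}$ is an intersecting family, then $$|\mathcal D(\mathcal F)|\le \sum_{0\le \ell<k}\binom{n-1}{\ell}.$$
   Context: $[n]=\{1,\dots,n\}$ and $\binom{[n]}{k}$ is the family of all $k$-element subsets of $[n]$. A family $\mathcal F$ is intersecting if $F\cap F'\neq\varnothing$ for all $F,F'\in\mathcal F$. For a family $\mathcal F$, $\mathcal D(\mathcal F):=\{F\setminus F' : F,F'\in\mathcal F\}$ (the family of setwise differences). Note that the right-hand side equals $|\mathcal D(\mathcal S_x)|$ for a full star $\mathcal S_x=\{A\in\binom{[n]}{k}: x\in A\}$. *)

(* Defs.v *)
From mathcomp Require Import all_boot.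
From Stdlib Require Import Reals.
Set Implicit Arguments. Unset Strict Implicit. Unset Printing Implicit Defensive.

Definition intersecting (T : finType) (F : {set {set T}}) : Prop :=
  forall A B, A \in F -> B \in F -> A :&: B != set0.

Definition diff_family (T : finType) (F : {set {set T}}) : {set {set T}} :=
  [set A :\: B | A in F, B in F].

(* Main.v *)
Require Import Defs.
From mathcomp Require Import all_boot all_fingroup zify.
From Stdlib Require Import Reals Lra.
Set Implicit Arguments. Unset Strict Implicit. Unset Printing Implicit Defensive.

(** Only [n >= 100 k] is needed.  Put [m = k - 1].  A difference [D] of size [m] has an apex: a point [y]
    outside [D] with [y |: D] in [F].  If few [m]-sets are differences, a crude count suffices.
    Otherwise colour each [m]-set in [D(F)] by an apex.  Two disjoint ones with different apexes must
    have the apex of one lying in the other, because [F] is intersecting; this is rare, so by a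
    Poincare inequality on the Kneser graph one apex [x] is shared by most [m]-sets.

    Let [G l] be the [l]-sets avoiding [x] and disjoint from some member of [F] avoiding [x].  Removing
    [x] from the differences through [x] yields sets in [G l] with [l < m], and there are few of these
    compared with [G m].  On the other hand [G m] is sparse, while almost all Kneser neighbours of a
    set in [G m :&: D(F)] lie in [G m]; by the Poincare inequality a fixed proportion of [G m] is
    therefore missing from [D(F)], which outweighs the differences through [x]. *)

(** * Counting sets by size, geometric sums and shadows *)

Lemma card_disjoint_draws (T : finType) (D : {set T}) m :
  #|[set E : {set T} | (#|E| == m) && [disjoint D & E]]| = 'C(#|T| - #|D|, m).
Proof.
rewrite -(cardsC D) addKn -cards_draws; apply: eq_card => E.
by rewrite !inE andbC disjoint_sym disjoints_subset.
Qed.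

Lemma card_by_size (T : finType) (Q : {set {set T}}) k :
  #|[set A in Q | #|A| < k]| = \sum_(0 <= l < k) #|[set A in Q | #|A| == l]|.
Proof.
elim: k => [|k IH].
  by rewrite big_geq //; apply: eq_card0 => A; rewrite !inE ltn0 andbF.
rewrite big_nat_recr //= -IH -cardsUI.
rewrite [X in _ = _ + X](_ : _ = 0) ?addn0; last first.
  by apply: eq_card0 => A; rewrite !inE; case: (A \in Q) => //=; lia.
by apply: eq_card => A; rewrite !inE; case: (A \in Q) => //=; lia.
Qed.

Lemma card_small_subsets (T : finType) (B : {set T}) k :
  #|[set A in powerset B | #|A| < k]| = \sum_(0 <= l < k) 'C(#|B|, l).
Proof.
rewrite card_by_size; apply: eq_bigr => l _; rewrite -cards_draws.
by apply: eq_card => A; rewrite !inE.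
Qed.

(** Induction: if [a m] bounds [c] times the sum below [m], adding the term [c * a m] gives at most
    [c.+1 * a m], hence at most [a m.+1]. *)
Lemma geometric_sum_le (a : nat -> nat) c m :
  (forall l, l < m -> c.+1 * a l <= a l.+1) ->
  c * \sum_(0 <= l < m) a l <= a m.
Proof.
elim: m => [|m IH] h; first by rewrite big_geq ?muln0.
rewrite big_nat_recr //= mulnDr.
have := IH (fun l lm => h l (ltnW lm)); have := h m (ltnSn m); rewrite mulSn; lia.
Qed.

(** Double count the pairs [(S, y)] with [S] in [A], [y] outside [S] and [y |: S] in [B]. For fixed
    [y], the map from [S] to [y |: S] is injective into the members of [B] containing [y]. *)
Lemma upper_shadow_double_count (T : finType) (A B : {set {set T}}) l d :
  (forall S, S \in B -> #|S| = l.+1) ->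
  (forall S, S \in A -> d <= #|[set y | (y \notin S) && (y |: S \in B)]|) ->
  d * #|A| <= l.+1 * #|B|.
Proof.
move=> sB dA.
have -> : l.+1 * #|B| = \sum_(y : T) #|[set S in B | y \in S]|.
  transitivity (\sum_(S in B) #|S|).
    by rewrite mulnC -sum_nat_const; apply: eq_bigr => S /sB.
  transitivity (\sum_(S in B) \sum_(y : T) (y \in S)).
    by apply: eq_bigr => S _; rewrite -sum1_card big_mkcond.
  rewrite exchange_big; apply: eq_bigr => y _.
  by rewrite -sum1_card [RHS]big_mkcond [LHS]big_mkcond; apply: eq_bigr => S _;
    rewrite inE; case: (S \in B).
apply: (@leq_trans (\sum_(S in A) #|[set y | (y \notin S) && (y |: S \in B)]|)).
  by rewrite mulnC -sum_nat_const; apply: leq_sum => S /dA.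
apply: (@leq_trans (\sum_(y : T) #|[set S in A | (y \notin S) && (y |: S \in B)]|)).
  rewrite (eq_bigr (fun S : {set T} => \sum_(y : T) ((y \notin S) && (y |: S \in B)))); last first.
    by move=> S _; rewrite -sum1_card big_mkcond; apply: eq_bigr => y _; rewrite inE.
  rewrite exchange_big /= leq_sum // => y _.
  by rewrite -sum1_card [X in X <= _]big_mkcond [X in _ <= X]big_mkcond leq_sum // => S _;
    rewrite inE; case: (S \in A).
apply: leq_sum => y _.
set C := [set S in A | _ & _].
have inj : {in C &, injective (fun S : {set T} => y |: S)}.
  move=> S S'; rewrite !inE => /and3P[_ yS _] /and3P[_ yS' _] e.
  by rewrite -(setU1K yS) e setU1K.
rewrite -(card_in_imset inj).
apply: subset_leq_card; apply/subsetP => S1 /imsetP[S]; rewrite inE => /and3P[_ _ SB] ->.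
by rewrite inE SB setU11.
Qed.

(** * Transitivity of permutations on ordered disjoint pairs *)

(** Induction on [#|A :\: B|]: transposing a point of [A :\: B] with one of [B :\: A] lowers it and
    moves only points of [A :|: B]. Control of the fixed points allows two such permutations to be
    composed below. *)
Lemma perm_between_sets (T : finType) (A B : {set T}) :
  #|A| = #|B| ->
  exists2 s : {perm T}, [set s z | z in A] = B & forall z, z \notin A :|: B -> s z = z.
Proof.
move: {2}#|_| (leqnn #|A :\: B|) => d; elim: d A => [|d IH] A hd eAB.
  have sAB : A \subset B by rewrite -setD_eq0 -cards_eq0 -leqn0.
  have -> : A = B by apply/eqP; rewrite eqEcard sAB eAB leqnn.
  exists 1%g => [|z _]; last by rewrite perm1.
  exact: etrans (eq_imset _ (@perm1 T)) (imset_id _).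
have [sAB|] := boolP (A \subset B).
  by apply: IH => //; move: sAB; rewrite -setD_eq0 => /eqP ->; rewrite cards0.
case/subsetPn => a aA aB.
have : 0 < #|B :\: A|.
  have := cardsID A B; have := cardsID B A; rewrite setIC eAB => <- /addnI ->.
  by rewrite card_gt0; apply/set0Pn; exists a; rewrite inE aA aB.
rewrite card_gt0 => /set0Pn[b]; rewrite inE => /andP[bA bB].
pose A' := [set tperm a b z | z in A].
have eA' : A' = b |: (A :\ a).
  apply/setP => z; apply/imsetP/idP => [[u uA ->]|].
    rewrite !inE; case: tpermP => [_|eu|]; rewrite ?eqxx //.
      by move: bA; rewrite -eu uA.
    by move=> /eqP -> _; rewrite uA orbT.
  rewrite !inE => /orP[/eqP ->|/andP[za zA]]; first by exists a; rewrite ?tpermL.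
  by exists z; rewrite ?tpermD // eq_sym //; apply: contraNneq bA => <-.
have [||s sA sf] := IH A'.
- suff -> : A' :\: B = (A :\: B) :\ a.
    by have := cardsD1 a (A :\: B); rewrite inE aA aB /=; lia.
  apply/setP => z; rewrite eA' !inE; case: (eqVneq z b) => [->|] /=; first by rewrite bB !andbF.
  by rewrite andbCA.
- by rewrite card_imset //; apply: perm_inj.
exists (tperm a b * s)%g.
  by rewrite -sA /A' -imset_comp; apply: eq_imset => z; rewrite permM.
move=> z; rewrite inE negb_or => /andP[zA zB]; rewrite permM tpermD; first last.
- by apply: contraNneq zB => <-.
- by apply: contraNneq zA => <-.
by apply: sf; rewrite eA' !inE (negbTE zA) (negbTE zB) andbF !orbF; apply: contraNneq zB => ->.
Qed.

Lemma perm_between_disjoint_pairs (T : finType) (A B A' B' : {set T}) :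
  #|A| = #|A'| -> #|B| = #|B'| -> [disjoint A & B] -> [disjoint A' & B'] ->
  exists2 s : {perm T}, [set s z | z in A] = A' & [set s z | z in B] = B'.
Proof.
move=> eA eB dAB dAB'.
have [s sB _] := perm_between_sets eB.
(* The image of [A] and its target [A'] are both disjoint from [B'], so [t] fixes [B'] pointwise and
   does not undo the work of [s]. *)
have [|t tA tf] := @perm_between_sets _ [set s z | z in A] A'.
  by rewrite card_imset //; apply: perm_inj.
exists (s * t)%g.
  by rewrite -tA -imset_comp; apply: eq_imset => z; rewrite permM.
rewrite -sB -[RHS]imset_id -[RHS]imset_comp.
apply: eq_in_imset => z zB; rewrite permM /=; apply: tf.
rewrite inE negb_or; apply/andP; split.
  rewrite mem_imset; last exact: perm_inj.
  by rewrite (disjointFl dAB zB).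
by rewrite (disjointFl dAB') // -sB imset_f.
Qed.

(** * Edge counts and a Poincare inequality in the Kneser graph *)

(** Edges of the Kneser graph are counted as ordered pairs, so that [R] may treat its two ends
    differently. *)
Definition kneser_pairs (T : finType) m (R : rel {set T}) : nat :=
  \sum_(D : {set T} | #|D| == m)
    \sum_(E : {set T} | (#|E| == m) && [disjoint D & E]) R D E.

Lemma kneser_pairs_sym (T : finType) m (R : rel {set T}) :
  kneser_pairs m R = kneser_pairs m (fun D E : {set T} => R E D).
Proof.
rewrite /kneser_pairs.
rewrite (exchange_big_dep (fun E : {set T} => #|E| == m)) /=; last by move=> D E _ /andP[].
apply: eq_bigr => D hD; apply: eq_bigl => E.
by rewrite hD disjoint_sym.
Qed.

Lemma kneser_pairs_le2 (T : finType) m (R R1 R2 : rel {set T}) :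
  (forall D E : {set T}, #|D| = m -> #|E| = m -> [disjoint D & E] -> R D E -> R1 D E || R2 D E) ->
  kneser_pairs m R <= kneser_pairs m R1 + kneser_pairs m R2.
Proof.
move=> h; rewrite /kneser_pairs -big_split leq_sum //= => D /eqP hD.
rewrite -big_split leq_sum //= => E /andP[/eqP hE hDE].
by have := h D E hD hE hDE; case: (R D E) => // /(_ isT); case: (R1 D E); case: (R2 D E).
Qed.

Lemma kneser_pairs_left (T : finType) m (S : {set {set T}}) :
  (forall D, D \in S -> #|D| = m) ->
  kneser_pairs m (fun D _ : {set T} => D \in S) = #|S| * 'C(#|T| - m, m).
Proof.
move=> hS; rewrite /kneser_pairs -sum_nat_const [RHS]big_mkcond [LHS]big_mkcond.
apply: eq_bigr => D _.
case: ifPn => [/eqP hD|]; last by case: ifP => // /hS ->; rewrite eqxx.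
rewrite sum_nat_const -cardsE card_disjoint_draws hD.
by case: (D \in S); rewrite ?muln1 ?muln0.
Qed.

(** Among the neighbours of [D], those containing a given point outside [D] form a proportion
    [m / (#|T| - m)], which is at most [1 / c]. *)
Lemma kneser_pairs_hit (T : finType) m c (S : {set {set T}}) (f : {set T} -> T) :
  c.+1 * m <= #|T| ->
  (forall D, D \in S -> #|D| = m) -> (forall D, D \in S -> f D \notin D) ->
  c * kneser_pairs m (fun D E : {set T} => (D \in S) && (f D \in E)) <= #|S| * 'C(#|T| - m, m).
Proof.
move=> cT hS hf; rewrite -kneser_pairs_left // /kneser_pairs big_distrr leq_sum //= => D /eqP hD.
have [DS|_] := boolP (D \in S); last by rewrite big1 ?muln0.
rewrite sum_nat_const muln1 -cardsE card_disjoint_draws hD.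
set Y := \sum_(_ | _) _.
have eY : Y + 'C(#|T| - m.+1, m) = 'C(#|T| - m, m).
  have fD := hf _ DS.
  have <- : #|f D |: D| = m.+1 by rewrite cardsU1 fD hD.
  rewrite -{2}hD -!card_disjoint_draws -!sum1_card [RHS](bigID (fun E : {set T} => f D \in E)) /=.
  congr (_ + _).
    rewrite /Y [LHS]big_mkcond [RHS]big_mkcond; apply: eq_bigr => E _.
    by rewrite inE; case: (_ && _); case: (_ \in _).
  apply: eq_bigl => E; rewrite !inE -andbA; congr (_ && _).
  rewrite -setI_eq0 -[in RHS]setI_eq0 setIUl setU_eq0 andbC; congr (_ && _).
  by rewrite setI_eq0 disjoints1.
case: m cT hS hD @Y eY => [|m] cT hS hD Y eY.
  by move: eY; rewrite !bin0; lia.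
(* Only for positive [c] is [#|T| - m.+1] surely nonzero, as the predecessor in [e1] requires. *)
case: c cT => [|c] cT; first by rewrite mul0n.
have e1 : #|T| - m.+1 = (#|T| - m.+2).+1 by nia.
have := mul_bin_diag (#|T| - m.+1) m.
have {}eY : Y = 'C(#|T| - m.+2, m) by move: eY; rewrite e1 binS; lia.
rewrite e1 /= -eY -(leq_pmul2l (ltn0Sn m)) => <-.
rewrite mulnA leq_mul2r -e1; apply/orP; right; nia.
Qed.

(* Two independent m-sets D1, D2 have a common neighbour E in the Kneser graph; a uniform such E makes
   (D1, E) and (E, D2) uniform edges, so a cut separating D1 from D2 cuts one of these.  The factor
   L clears the denominators of the conditional probabilities. *)
Lemma kneser_poincare (T : finType) m (S : {set {set T}}) :
  3 * m <= #|T| -> (forall D, D \in S -> #|D| = m) ->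
  #|S| * ('C(#|T|, m) - #|S|) * 'C(#|T| - m, m) <=
  2 * 'C(#|T|, m) * kneser_pairs m (fun D E : {set T} => (D \in S) && (E \notin S)).
Proof.
move=> mT hS.
set M := 'C(#|T|, m); set d := 'C(_ - m, m); set e := kneser_pairs _ _.
have cardK : #|[set D : {set T} | #|D| == m]| = M by apply: card_draws.
(* Each of these binomials lies between 1 and [M], so it divides the factorial of [M]. *)
have [L L0 dvdL] : exists2 L, 0 < L & forall u, u <= 2 * m -> 'C(#|T| - u, m) %| L.
  exists M`! => [|u um]; first exact: fact_gt0.
  by apply: dvdn_fact; rewrite bin_gt0 leq_bin2l ?leq_subr // andbT; lia.
pose w (D1 D2 : {set T}) := L %/ 'C(#|T| - #|D1 :|: D2|, m).
have wE (D1 D2 : {set T}) : #|D1| = m -> #|D2| = m ->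
    \sum_(E : {set T} | (#|E| == m) && ([disjoint D1 & E] && [disjoint D2 & E])) w D1 D2 = L.
  move=> h1 h2; rewrite sum_nat_const.
  have -> : #|[pred E : {set T} | (#|E| == m) && ([disjoint D1 & E] && [disjoint D2 & E])]|
            = 'C(#|T| - #|D1 :|: D2|, m).
    rewrite -card_disjoint_draws -[LHS]cardsE; apply: eq_card => E.
    by rewrite !inE -!setI_eq0 setIUl setU_eq0.
  rewrite mulnC divnK //; apply: dvdL.
  have := cardsUI D1 D2; lia.
pose W (D E : {set T}) := \sum_(D2 : {set T} | (#|D2| == m) && [disjoint D2 & E]) w D D2.
(* A permutation carries any edge to any other and preserves the weights: this is the uniformity of
   the edge [(D1, E)]. *)
have Wconst (D E D' E' : {set T}) : #|D| = m -> #|E| = m -> #|D'| = m -> #|E'| = m ->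
    [disjoint D & E] -> [disjoint D' & E'] -> W D E = W D' E'.
  move=> hD hE hD' hE' dDE dDE'.
  have [||s sD sE] := @perm_between_disjoint_pairs _ D E D' E' _ _ dDE dDE'; rewrite ?hD ?hE //.
  have si : injective s by apply: perm_inj.
  rewrite /W [RHS](reindex_inj (imset_inj si)) /=.
  apply: eq_big => [X|X _]; last first.
    by rewrite /w -sD -imsetU card_imset.
  by rewrite card_imset // -sE imset_disjoint.
have [T0|/set0Pn[D0]] := eqVneq [set D : {set T} | #|D| == m] set0.
  by have: 0 < M by [rewrite bin_gt0; lia]; rewrite -cardK T0 cards0.
rewrite inE => /eqP hD0.
have : 0 < #|[set E : {set T} | (#|E| == m) && [disjoint D0 & E]]|.
  by rewrite card_disjoint_draws hD0 bin_gt0; lia.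
rewrite card_gt0 => /set0Pn[E0]; rewrite inE => /andP[/eqP hE0 dDE0].
set W0 := W D0 E0.
have triple (R : {set T} -> {set T} -> {set T} -> nat) :
   \sum_(D1 : {set T} | #|D1| == m) \sum_(D2 : {set T} | #|D2| == m)
     \sum_(E : {set T} | (#|E| == m) && ([disjoint D1 & E] && [disjoint D2 & E])) R D1 D2 E =
   \sum_(D1 : {set T} | #|D1| == m) \sum_(E : {set T} | (#|E| == m) && [disjoint D1 & E])
     \sum_(D2 : {set T} | (#|D2| == m) && [disjoint D2 & E]) R D1 D2 E.
  apply: eq_bigr => D1 _.
  rewrite (exchange_big_dep (fun E : {set T} => (#|E| == m) && [disjoint D1 & E])) /=.
    by apply: eq_bigr => E /andP[-> ->].
  by move=> D2 E _ /and3P[-> -> _].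
have sumW (R : rel {set T}) :
    \sum_(D1 : {set T} | #|D1| == m) \sum_(E : {set T} | (#|E| == m) && [disjoint D1 & E])
     \sum_(D2 : {set T} | (#|D2| == m) && [disjoint D2 & E]) R D1 E * w D1 D2
    = kneser_pairs m R * W0.
  rewrite big_distrl /=; apply: eq_bigr => D1 /eqP h1.
  rewrite big_distrl /=; apply: eq_bigr => E /andP[/eqP hE dE].
  by rewrite -big_distrr /=; congr (_ * _); apply: Wconst.
(* The total weight of all triples is [M * M * L] summed over [(D1, D2)], and [M * d * W0] summed
   over edges [(D1, E)]. *)
have W0E : W0 * d = M * L.
  have M0 : 0 < M by rewrite bin_gt0; lia.
  apply/eqP; rewrite -(eqn_pmul2l M0); apply/eqP.
  have total : \sum_(D1 : {set T} | #|D1| == m) \sum_(D2 : {set T} | #|D2| == m)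
     \sum_(E : {set T} | (#|E| == m) && ([disjoint D1 & E] && [disjoint D2 & E])) true * w D1 D2
     = M * (M * L).
    transitivity (\sum_(D1 in [set D : {set T} | #|D| == m])
                    \sum_(D2 in [set D : {set T} | #|D| == m]) L); last first.
      by rewrite !sum_nat_const cardK.
    apply: eq_big => [D1|D1 /eqP h1]; rewrite ?inE //.
    apply: eq_big => [D2|D2 /eqP h2]; rewrite ?inE //.
    by rewrite -(wE D1 D2) //; apply: eq_bigr => E _; rewrite mul1n.
  rewrite -total (triple (fun D1 D2 E => true * w D1 D2)) (sumW (fun _ _ => true)).
  have -> : kneser_pairs m (fun _ _ : {set T} => true)
          = kneser_pairs m (fun D _ : {set T} => D \in [set D : {set T} | #|D| == m]).
    by apply: eq_bigr => D hD; apply: eq_bigr => E _; rewrite inE hD.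
  rewrite kneser_pairs_left => [|D]; last by rewrite inE => /eqP.
  by rewrite cardK -/d [W0 * d]mulnC mulnA.
have main : #|S| * (M - #|S|) * L <= 2 * (e * W0).
  have -> : #|S| * (M - #|S|) * L = \sum_(D1 : {set T} | #|D1| == m)
      \sum_(D2 : {set T} | #|D2| == m)
       \sum_(E : {set T} | (#|E| == m) && ([disjoint D1 & E] && [disjoint D2 & E]))
         ((D1 \in S) && (D2 \notin S)) * w D1 D2.
    transitivity (\sum_(D1 in S) \sum_(D2 in [set D : {set T} | #|D| == m] :\: S) L).
      rewrite !sum_nat_const cardsD cardK (setIidPr _) ?mulnA //.
      by apply/subsetP => D /hS; rewrite inE => ->.
    rewrite [LHS]big_mkcond [RHS]big_mkcond; apply: eq_bigr => D1 _.
    case: ifPn => [D1S|D1S]; last first.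
      by case: ifP => // _; rewrite big1 // => D2 _; rewrite big1.
    rewrite (hS _ D1S) eqxx [LHS]big_mkcond [RHS]big_mkcond; apply: eq_bigr => D2 _.
    rewrite !inE; case: (eqVneq #|D2| m) => [h2|_]; last by rewrite andbF.
    rewrite andbT /=; case: (D2 \in S) => /=; first by rewrite big1.
    by rewrite -(wE D1 D2 (hS _ D1S) h2); apply: eq_bigr => E _; rewrite mul1n.
  apply: (@leq_trans (\sum_(D1 : {set T} | #|D1| == m)
      \sum_(D2 : {set T} | #|D2| == m)
       \sum_(E : {set T} | (#|E| == m) && ([disjoint D1 & E] && [disjoint D2 & E]))
         ((D1 \in S) && (E \notin S) * w D1 D2 + (E \in S) && (D2 \notin S) * w D1 D2))).
    do 3!(apply: leq_sum => ? _).
    by rewrite -mulnDl leq_mul2r; do 3!case: (_ \in S); rewrite /= ?orbT.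
  rewrite (eq_bigr (fun D1 : {set T} =>
    \sum_(D2 : {set T} | #|D2| == m)
       \sum_(E : {set T} | (#|E| == m) && ([disjoint D1 & E] && [disjoint D2 & E]))
         ((D1 \in S) && (E \notin S) * w D1 D2) +
    \sum_(D2 : {set T} | #|D2| == m)
       \sum_(E : {set T} | (#|E| == m) && ([disjoint D1 & E] && [disjoint D2 & E]))
         ((E \in S) && (D2 \notin S) * w D1 D2))); last first.
    by move=> D1 _; rewrite -big_split; apply: eq_bigr => D2 _; rewrite big_split.
  rewrite big_split /= mul2n -addnn leq_add //.
    by rewrite (triple (fun D1 D2 E : {set T} => ((D1 \in S) && (E \notin S)) * w D1 D2)) sumW.
  (* Swapping the roles of [D1] and [D2] turns the second half into a sum over reversed cut
     edges. *)
  rewrite exchange_big /=.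
  rewrite (eq_bigr (fun D1 : {set T} => \sum_(D2 : {set T} | #|D2| == m)
       \sum_(E : {set T} | (#|E| == m) && ([disjoint D1 & E] && [disjoint D2 & E]))
         ((E \in S) && (D1 \notin S) * w D1 D2))); last first.
    move=> D1 _; apply: eq_bigr => D2 _; apply: eq_big => [E|E _]; first by rewrite andbA andbAC -andbA.
    by rewrite /w setUC.
  rewrite (triple (fun D1 D2 E : {set T} => ((E \in S) && (D1 \notin S)) * w D1 D2)).
  by rewrite (sumW (fun D E : {set T} => (E \in S) && (D \notin S))) -kneser_pairs_sym.
rewrite -(leq_pmul2l L0).
have -> : L * (2 * M * e) = 2 * (e * W0) * d by move: W0E; clear; clearbody M d e W0; nia.
by rewrite mulnA [L * _]mulnC leq_mul2r main orbT.
Qed.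

(** * Two consequences of the Poincare inequality *)

(** If every colour class were below [4/5] of all [m]-sets, summing the Poincare inequality over the
    classes would give at least [#|S| * d / 10] edges leaving their class. Such an edge leaves [S]
    or has the colour of one end inside the other, and there are too few of these. *)
Lemma large_colour_class (T : finType) m (S : {set {set T}}) (c : {set T} -> T) :
  100 * m <= #|T| -> (forall D, D \in S -> #|D| = m) ->
  25 * ('C(#|T|, m) - #|S|) <= 'C(#|T|, m) ->
  (forall D, D \in S -> c D \notin D) ->
  (forall D E, D \in S -> E \in S -> [disjoint D & E] ->
    [|| c D == c E, c D \in E | c E \in D]) ->
  exists x, 4 * 'C(#|T|, m) <= 5 * #|[set D in S | c D == x]|.
Proof.
set M := 'C(_, m) => mT hS hM hc hcc.
pose X x := [set D in S | c D == x].
have [x hx|hX] := pickP (fun x => 4 * M <= 5 * #|X x|); first by exists x.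
set d := 'C(#|T| - m, m).
have d0 : 0 < d by rewrite bin_gt0; lia.
have M0 : 0 < M by rewrite bin_gt0; lia.
have sumX : \sum_x #|X x| = #|S|.
  rewrite -sum1_card (partition_big c predT) //=; apply: eq_bigr => x _.
  by rewrite -sum1_card; apply: eq_bigl => D; rewrite inE.
pose e := kneser_pairs m (fun D E : {set T} => (D \in S) && ~~ ((E \in S) && (c E == c D))).
have sume : \sum_x kneser_pairs m (fun D E : {set T} => (D \in X x) && (E \notin X x)) = e.
  rewrite exchange_big; apply: eq_bigr => D _; rewrite exchange_big; apply: eq_bigr => E _.
  rewrite (bigD1 (c D)) //= big1 ?addn0 => [|x xD]; first by rewrite !inE eqxx andbT.
  by rewrite !inE eq_sym (negbTE xD) andbF.
have lower : #|S| * M * d <= 10 * (M * e).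
  rewrite -sume -sumX !big_distrl !big_distrr leq_sum //= => x _.
  have hXm D : D \in X x -> #|D| = m by rewrite inE => /andP[/hS].
  have mT3 : 3 * m <= #|T| by lia.
  have := kneser_poincare mT3 hXm; rewrite -/M -/d.
  have := hX x; set a := #|_|; set p := kneser_pairs _ _.
  nia.
have {}lower : #|S| * d <= 10 * e.
  by rewrite -(leq_pmul2l M0); move: lower; nia.
have upper : 99 * e <= (99 * (M - #|S|) + 2 * #|S|) * d.
  pose K := [set D : {set T} | #|D| == m].
  have e1 : kneser_pairs m (fun D E : {set T} => E \in K :\: S) = (M - #|S|) * d.
    rewrite kneser_pairs_sym kneser_pairs_left => [|D]; last by rewrite !inE => /andP[_ /eqP].
    rewrite cardsD (setIidPr _) ?card_draws //.
    by apply/subsetP => D /hS; rewrite inE => ->.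
  have e2 := @kneser_pairs_hit _ m 99 S c mT hS hc.
  have : e <= kneser_pairs m (fun D E : {set T} => E \in K :\: S)
       + kneser_pairs m (fun D E : {set T} => (D \in S) && (c D \in E) || (E \in S) && (c E \in D)).
    apply: kneser_pairs_le2 => D E hD hE dDE /andP[DS].
    rewrite !inE hE eqxx DS; case ES: (E \in S) => //=.
    have := hcc D E DS ES dDE; rewrite eq_sym => /or3P[-> //|->|->]; rewrite ?orbT //.
  have : kneser_pairs m (fun D E : {set T} => (D \in S) && (c D \in E) || (E \in S) && (c E \in D))
      <= kneser_pairs m (fun D E : {set T} => (D \in S) && (c D \in E))
       + kneser_pairs m (fun D E : {set T} => (E \in S) && (c E \in D)).
    by apply: kneser_pairs_le2.
  rewrite -[kneser_pairs _ (fun D E => (E \in S) && _)]kneser_pairs_sym e1.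
  rewrite mulnDl -!mulnA; move: e2; rewrite -/d; lia.
(* This is contradictory: [#|S|] is at least [24 * (M - #|S|)], and [79 * 24] exceeds 990. *)
suff : 99 * #|S| <= 990 * (M - #|S|) + 20 * #|S| by lia.
rewrite -(leq_pmul2r d0); move: lower upper; move: #|S| (M - #|S|); clear; clearbody e d => s u.
nia.
Qed.

(** As [H] has density at most [1/5], at least [2/5] of the edges from [H] leave it. At most [2/99]
    leave [G]; the others end in [G :\: H], where each set absorbs at most [d] of them. Since
    [2/5 - 2/99] exceeds [1/3], [G :\: H] has at least a third of the size of [H]. *)
Lemma kneser_expansion (T : finType) m (H G : {set {set T}}) :
  3 * m <= #|T| -> (forall D, D \in G -> #|D| = m) -> H \subset G ->
  5 * #|G| <= 'C(#|T|, m) ->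
  99 * kneser_pairs m (fun D E => (D \in H) && (E \notin G)) <= 2 * #|H| * 'C(#|T| - m, m) ->
  #|G| <= 4 * #|G :\: H|.
Proof.
set M := 'C(_, m); set d := 'C(_, m) => mT hG sHG GM hHG.
have d0 : 0 < d by rewrite bin_gt0; lia.
have M0 : 0 < M by rewrite bin_gt0; lia.
have hH D : D \in H -> #|D| = m by move/(subsetP sHG)/hG.
have := kneser_poincare mT hH; rewrite -/M -/d; set e := kneser_pairs _ _ => poinc.
have eL : kneser_pairs m (fun D E : {set T} => E \in G :\: H) = #|G :\: H| * d.
  by rewrite kneser_pairs_sym kneser_pairs_left // => D; rewrite inE => /andP[_ /hG].
have : e <= kneser_pairs m (fun D E : {set T} => (D \in H) && (E \notin G))
          + kneser_pairs m (fun D E : {set T} => E \in G :\: H).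
  apply: kneser_pairs_le2 => D E _ _ _ /andP[-> EH]; rewrite !inE EH /=.
  by case: (E \in G).
rewrite eL => he.
have gE : #|G| = #|H| + #|G :\: H| by rewrite -(cardsID H G) (setIidPr sHG).
set h := #|H| in gE poinc hHG *; set l := #|G :\: H| in gE he *.
have {}he : 99 * e <= (2 * h + 99 * l) * d.
  by rewrite mulnDl -mulnA; lia.
have {}poinc : 396 * h <= 10 * (2 * h + 99 * l).
  have dM0 : 0 < d * M by rewrite muln_gt0 d0.
  rewrite -(leq_pmul2r dM0).
  have : 4 * M <= 5 * (M - h) by lia.
  rewrite -(leq_pmul2r d0) => /(leq_mul (leqnn h)).
  move: poinc he; clear; clearbody e h l d M => p q r.
  move: (M - h) p r (leq_mul (leqnn (10 * M)) q) => z p r; clear q; lia.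
by rewrite gE; lia.
Qed.

(** * Sizes and apexes of differences *)

Lemma card_diff_lt (T : finType) m (F : {set {set T}}) D :
  (forall A, A \in F -> #|A| = m.+1) -> intersecting F ->
  D \in diff_family F -> #|D| < m.+1.
Proof.
move=> hF iF /imset2P[A B AF BF ->]; rewrite -(hF A AF) -(cardsID B A).
by have := iF A B AF BF; rewrite -card_gt0; lia.
Qed.

(** When [A :\: B] has size [m], the sets [A] and [B] share exactly one point, and restoring it
    gives [A]. *)
Lemma top_diff_apex (T : finType) m (F : {set {set T}}) D :
  (forall A, A \in F -> #|A| = m.+1) -> D \in diff_family F -> #|D| = m ->
  exists2 y, y \notin D & y |: D \in F.
Proof.
move=> hF /imset2P[A B AF BF ->] hD.
have /eqP/cards1P[y eAB] : #|A :&: B| = 1.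
  by have := cardsID B A; rewrite (hF A AF) hD; lia.
have yAB : y \in A :&: B by rewrite eAB set11.
exists y; first by move: yAB; rewrite !inE => /andP[_ ->].
by rewrite -eAB setID.
Qed.

Lemma top_diff_apex_fun (T : finType) (x0 : T) m (F : {set {set T}}) :
  (forall A, A \in F -> #|A| = m.+1) ->
  exists c : {set T} -> T, forall D, D \in diff_family F -> #|D| = m ->
    c D \notin D /\ c D |: D \in F.
Proof.
move=> hF; exists (fun D : {set T} => odflt x0 [pick y | (y \notin D) && (y |: D \in F)]) => D DF hD.
case: pickP => [y /andP[] //|h].
by have [y yD yF] := top_diff_apex hF DF hD; have := h y; rewrite yD yF.
Qed.

(** Below [m], the ratio [(n - l) / (l + 1)] of consecutive binomials is at least [c + 1]. *)
Lemma sum_bin_lt_le n m c : c.+2 * m <= n -> c * \sum_(0 <= l < m) 'C(n, l) <= 'C(n, m).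
Proof.
move=> mn; apply: geometric_sum_le => l lm.
rewrite -(leq_pmul2l (ltn0Sn l)) mul_bin_left mulnA leq_mul2r; apply/orP; right; nia.
Qed.

(** * The bound when top differences are few, and near a star *)

(** The top layer has fewer than [24/25 * M] sets and the lower layers at most [M / 96]. Together
    this is below [99/100 * M], which the last term on the right already reaches. *)
Lemma card_diff_few_top (T : finType) m (F : {set {set T}}) :
  100 * m.+1 <= #|T| ->
  (forall A, A \in F -> #|A| = m.+1) -> intersecting F ->
  'C(#|T|, m) < 25 * ('C(#|T|, m) - #|[set D in diff_family F | #|D| == m]|) ->
  #|diff_family F| <= \sum_(0 <= l < m.+1) 'C(#|T|.-1, l).
Proof.
move=> mT hF iF; set M := 'C(_, _); set s := #|[set D in _ | _]| => hs.
have le1 : #|diff_family F| <= s + \sum_(0 <= l < m) 'C(#|T|, l).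
  rewrite -cardsT -card_small_subsets; apply: leq_trans (leq_card_setU _ _).
  apply: subset_leq_card; apply/subsetP => D DF.
  have := card_diff_lt hF iF DF; rewrite !inE DF subsetT /=; lia.
have mT98 : 98 * m <= #|T| by lia.
have le2 := @sum_bin_lt_le #|T| m 96 mT98.
have le3 : 99 * M <= 100 * 'C(#|T|.-1, m).
  have T0 : 0 < #|T| by lia.
  have := mul_bin_down #|T| m; rewrite -/M => e.
  rewrite -(leq_pmul2l T0) [X in _ <= X]mulnCA e.
  rewrite [X in _ <= X]mulnA mulnCA mulnA leq_mul2r; apply/orP; right; lia.
rewrite big_nat_recr //=; move: le1 le2 le3 hs; rewrite -/M -/s.
set a := \sum_(_ <= _ < _) _; set b := \sum_(_ <= _ < _) _; clear; clearbody a b s M.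
by move: #|_| 'C(_, _); lia.
Qed.

(** The right side counts the sets of size at most [m] avoiding [x]. The differences miss at least
    [#|G m| / 4] of these, while at most [#|G m| / 97] differences contain [x]. *)
Lemma card_diff_near_star (T : finType) m (F : {set {set T}}) x :
  100 * m.+1 <= #|T| ->
  (forall A, A \in F -> #|A| = m.+1) -> intersecting F ->
  4 * 'C(#|T|, m) <= 5 * #|[set D : {set T} | [&& #|D| == m, x \notin D & x |: D \in F]]| ->
  #|diff_family F| <= \sum_(0 <= l < m.+1) 'C(#|T|.-1, l).
Proof.
move=> mT hF iF hx.
pose Q : {set {set T}} := [set S : {set T} | (x \notin S) && [exists A in F, (x \notin A) && [disjoint A & S]]].
pose G (l : nat) : {set {set T}} := [set S in Q | #|S| == l].
pose H := G m :&: diff_family F.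
have G_witness l (S : {set T}) : S \in G l ->
    [/\ x \notin S, #|S| = l & exists A, [/\ A \in F, x \notin A & [disjoint A & S]]].
  rewrite !inE => /andP[/andP[xS /exists_inP[A AF /andP[xA dA]]] /eqP hS].
  by split=> //; exists A.
have G_intro l (S A : {set T}) : x \notin S -> #|S| = l -> A \in F -> x \notin A ->
    [disjoint A & S] -> S \in G l.
  move=> xS hS AF xA dA; rewrite !inE xS hS eqxx andbT /=.
  by apply/exists_inP; exists A; rewrite ?xA.
have star_free (D : {set T}) : x \notin D -> x |: D \in F -> D \notin G m.
  move=> xD xDF; apply/negP => /G_witness[_ _ [A [AF xA dA]]].
  have /set0Pn[z] := iF _ _ AF xDF; rewrite !inE => /andP[zA /orP[/eqP zx|zD]].
    by move: xA; rewrite -zx zA.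
  by rewrite (disjointFr dA zA) in zD.
have G_small : 5 * #|G m| <= 'C(#|T|, m).
  set S := [set D | _] in hx.
  have : #|G m :|: S| <= 'C(#|T|, m).
    rewrite -card_draws; apply: subset_leq_card; apply/subsetP => D.
    by rewrite !inE => /orP[/andP[_ ->]|/and3P[-> _ _]].
  rewrite cardsU (_ : G m :&: S = set0) ?cards0 ?subn0.
    by move: hx; move: #|S| #|G m| 'C(_, _); clear; lia.
  apply/setP => D; rewrite inE [D \in S]inE [D \in set0]inE; apply/negP => /andP[DG /and3P[_ xD xF]].
  by move: (star_free D xD xF); rewrite DG.
have loss : #|G m| <= 4 * #|G m :\: H|.
  have mT3 : 3 * m <= #|T| by lia.
  have mT100 : 100 * m <= #|T| by lia.
  have Gm D : D \in G m -> #|D| = m by move=> /G_witness[].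
  have Hm D : D \in H -> #|D| = m by rewrite in_setI => /andP[/Gm].
  apply: (kneser_expansion mT3 Gm _ G_small); first exact: subsetIl.
  have [c hc] := top_diff_apex_fun x hF.
  have xH D : D \in H -> x \notin D by rewrite in_setI => /andP[/G_witness[]].
  have cH D : D \in H -> c D \notin D /\ c D |: D \in F.
    by move=> DH; apply: hc (Hm _ DH); move: DH; rewrite in_setI => /andP[].
  have h1 := @kneser_pairs_hit _ m 99 H (fun _ : {set T} => x) mT100 Hm xH.
  have h2 := @kneser_pairs_hit _ m 99 H c mT100 Hm (fun D DH => (cH D DH).1).
  (* A neighbour [E] of [D] containing neither [x] nor [c D] is disjoint from [c D |: D]. This
     member of [F] avoids [x], since [star_free] excludes [c D = x]; so it witnesses [E \in G m]. *)
  have : kneser_pairs m (fun D E : {set T} => (D \in H) && (E \notin G m)) <=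
     kneser_pairs m (fun D E : {set T} => (D \in H) && (x \in E)) +
     kneser_pairs m (fun D E : {set T} => (D \in H) && (c D \in E)).
    apply: kneser_pairs_le2 => D E hD hE dDE /andP[DH]; rewrite DH /=.
    apply: contraR; rewrite negb_or => /andP[xE cE].
    have [cD cF] := cH D DH.
    have DG : D \in G m by move: DH; rewrite in_setI => /andP[].
    have [xD _ _] := G_witness _ _ DG.
    have xc : x != c D by apply: contraTneq DG => e; apply: star_free; rewrite // e.
    apply: (G_intro _ _ (c D |: D)) => //.
      by rewrite !inE negb_or xc.
    by rewrite -setI_eq0 setIUl setU_eq0 !setI_eq0 disjoints1 cE.
  move: h1 h2; set p := kneser_pairs _ _; set q := kneser_pairs _ _; set r := kneser_pairs _ _.
  by rewrite -mulnA; set hd := #|H| * _; lia.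
(* With the same witness [A], a set [S] in [G l] extends by any point outside [x], [A] and [S],
   which together have at most [1 + (m + 1) + l] points. *)
have gain : 97 * \sum_(0 <= l < m) #|G l| <= #|G m|.
  apply: (@geometric_sum_le (fun l => #|G l|)) => l lm.
  rewrite -(leq_pmul2l (ltn0Sn l)).
  apply: leq_trans (@upper_shadow_double_count T (G l) (G l.+1) l (#|T| - (m + l + 2)) _ _).
  - rewrite mulnA leq_mul2r; apply/orP; right; nia.
  - by move=> S /G_witness[].
  move=> S /G_witness[xS hS [A [AF xA dA]]].
  apply: (@leq_trans #|~: (x |: (A :|: S))|).
    have := cardsC (x |: (A :|: S)); have := leq_of_leqif (leq_card_setU A S).
    by rewrite cardsU1 hS (hF _ AF); case: (_ \notin _); lia.
  apply: subset_leq_card; apply/subsetP => y.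
  rewrite [y \in ~: _]inE !in_setU !negb_or in_set1 => /and3P[yx yA yS].
  rewrite inE yS /=; apply: (G_intro _ _ A) => //.
  - by rewrite !inE negb_or eq_sym yx.
  - by rewrite cardsU1 yS hS.
  by rewrite -setI_eq0 setIUr setU_eq0 !setI_eq0 disjoint_sym disjoints1 yA.
pose P : {set {set T}} := [set A in powerset (~: [set x]) | #|A| < m.+1].
have cP : #|P| = \sum_(0 <= l < m.+1) 'C(#|T|.-1, l) by rewrite card_small_subsets cardsC1.
have GP : G m :\: H \subset P.
  apply/subsetP => D; rewrite inE => /andP[_ /G_witness[xD hD _]].
  by rewrite !inE hD leqnn andbT subsetC sub1set inE.
rewrite -cP -(cardsID [set D : {set T} | x \in D] (diff_family F)).
have avoid : #|diff_family F :\: [set D : {set T} | x \in D]| + #|G m :\: H| <= #|P|.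
  rewrite -(cardsID (G m :\: H) P) addnC leq_add //.
    by rewrite (setIidPr GP).
  apply: subset_leq_card; apply/subsetP => D /setDP[DF]; rewrite inE => xD.
  rewrite in_setD [D \in G m :\: H]in_setD [D \in H]in_setI DF andbT andNb /=.
  have hD := card_diff_lt hF iF DF.
  by rewrite !inE hD andbT subsetC sub1set inE.
(* If [x] lies in [A :\: B], then [B] avoids [x] and is disjoint from the difference, so [B]
   witnesses that removing [x] gives a set of [Q]. *)
have through : #|diff_family F :&: [set D : {set T} | x \in D]| <= \sum_(0 <= l < m) #|G l|.
  rewrite -card_by_size.
  rewrite -(@card_in_imset _ _ (fun D : {set T} => D :\ x)); last first.
    move=> D E; rewrite !inE => /andP[_ xD] /andP[_ xE] e.
    by rewrite -(setD1K xD) e setD1K.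
  apply: subset_leq_card; apply/subsetP => S /imsetP[D]; rewrite !inE => /andP[DF xD] ->.
  have hD := card_diff_lt hF iF DF.
  rewrite !inE eqxx /=; apply/andP; split; last first.
    by move: hD; rewrite (cardsD1 x D) xD.
  move: DF xD => /imset2P[A B AF BF ->]; rewrite inE => /andP[xB xA].
  apply/exists_inP; exists B => //; rewrite xB /= -setI_eq0; apply/eqP/setP => z.
  by rewrite !inE; case: (z \in B); rewrite ?andbF.
move: avoid through gain loss; set a := \sum_(_ <= _ < _) _.
by move: #|_ :\: H| #|_ :\: _| #|_ :&: _| #|P| #|G m|; clear; clearbody a; lia.
Qed.

(** * Combining the cases, and the logarithmic hypothesis *)

Lemma card_diff_family_le (T : finType) m (F : {set {set T}}) :
  100 * m.+1 <= #|T| ->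
  (forall A, A \in F -> #|A| = m.+1) -> intersecting F ->
  #|diff_family F| <= \sum_(0 <= l < m.+1) 'C(#|T|.-1, l).
Proof.
move=> mT hF iF.
set S := [set D in diff_family F | #|D| == m].
have [few|many] := ltnP 'C(#|T|, m) (25 * ('C(#|T|, m) - #|S|)).
  exact: card_diff_few_top.
have T0 : 0 < #|T| by lia.
have /card_gt0P[x0 _] := T0.
have [c hc] := top_diff_apex_fun x0 hF.
have cS D : D \in S -> c D \notin D /\ c D |: D \in F.
  by rewrite inE => /andP[DF /eqP hD]; apply: hc.
have mT100 : 100 * m <= #|T| by lia.
have Sm D : D \in S -> #|D| = m by rewrite inE => /andP[_ /eqP].
have [||x hx] := @large_colour_class T m S c mT100 Sm many.
- by move=> D /cS[].
(* The members [c D |: D] and [c E |: E] meet; as [D] and [E] are disjoint, a common point must be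
   one of the apexes. *)
- move=> D E /cS[cD DF] /cS[cE EF] dDE.
  have /set0Pn[z] := iF _ _ DF EF; rewrite !inE.
  case/andP=> /orP[/eqP ->|zD] /orP[/eqP ez|zE].
  + by rewrite ez eqxx.
  + by rewrite zE orbT.
  + by rewrite -ez zD !orbT.
  by rewrite (disjointFr dDE zD) in zE.
apply: (@card_diff_near_star _ _ _ x) => //; apply: leq_trans hx _.
rewrite leq_mul2l; apply: subset_leq_card; apply/subsetP => D; rewrite inE => /andP[DS /eqP ex].
by have [] := cS D DS; rewrite inE ex (Sm _ DS) eqxx => -> ->.
Qed.

Theorem mainTheorem1 (n k : nat) (F : {set {set 'I_n}}) :
  0 < n -> 50 <= k ->
  (50 * INR k * ln (INR k) <= INR n)%R ->
  (forall A, A \in F -> #|A| = k) ->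
  intersecting F ->
  #|diff_family F| <= \sum_(0 <= l < k) 'C(n.-1, l).
Proof.
move=> _ k50 hln hF iF.
(* Since [exp 1] is at most 3 and [k] is at least 9, [ln k] is at least 2. *)
have kn : 100 * k <= n.
  have k9 : (9 <= INR k)%R.
    have -> : 9%R = INR 9 by rewrite INR_IZR_INZ.
    by apply: le_INR; apply/leP; lia.
  have ln2 : (2 <= ln (INR k))%R.
    have e1 := exp_le_3; have e0 := exp_pos 1.
    have e2 : (exp 2 <= INR k)%R.
      by have -> : 2%R = (1 + 1)%R by []; rewrite exp_plus; nra.
    rewrite -(ln_exp 2); case: (Rle_lt_or_eq_dec _ _ e2) => [lt|<-]; last exact: Rle_refl.
    by apply/Rlt_le/ln_increasing => //; apply: exp_pos.
  apply/leP/INR_le; rewrite mult_INR.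
  have -> : INR 100 = 100%R by rewrite INR_IZR_INZ.
  nra.
case: k k50 kn hF {hln} => // m _ mT hF.
have := @card_diff_family_le _ m F; rewrite card_ord; exact.
Qed.
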